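(* Let $\mathcal H$ be a complex Hilbert space and let $\mathrm U(\mathcal H)$ be the group of all unitary operators $\mathcal H\to\mathcal H$. Then $\mathrm U(\mathcal H)$ is a topological group with respect to the strong topology; that is, the composition $\mathrm U(\mathcal H)\times \mathrm U(\mathcal H)\to \mathrm U(\mathcal H)$, $(S,T)\mapsto ST$, and the inversion $\mathrm U(\mathcal H)\to\mathrm U(\mathcal H)$, $T\mapsto T^{-1}$, are continuous when $\mathrm U(\mathcal H)$ carries the strong topology (and the product carries the product topology).
   Context: The strong topology on $\mathrm U(\mathcal H)$ is the strong operator topology, i.e. the topology of pointwise convergence on $\mathcal H$ in norm: a subbasis is given by the sets $\{R\in \mathrm U(\mathcal H): \|(R-R_0)f\|<\varepsilon\}$ with $R_0\in \mathrm U(\mathcal H)$, $f\in\mathcal H$, $\varepsilon>0$. *)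

(* Defs.v *)
From HB Require Import structures.
From mathcomp Require Import all_boot all_order all_algebra.
From mathcomp Require Import sesquilinear complex.
From mathcomp Require Import all_classical all_reals all_analysis.

Set Implicit Arguments.
Unset Strict Implicit.
Unset Printing Implicit Defensive.

Import Order.TTheory GRing.Theory Num.Theory.
Import numFieldNormedType.Exports.

Local Open Scope classical_set_scope.
Local Open Scope complex_scope.
Local Open Scope ring_scope.

(* The positive definite Hermitian form is linear in its first argument and
   conjugate-linear in the second; its values, like the norm, live in R[i]. *)
HB.mixin Record CompleteNormedModule_isHilbert (R : realType) H
    & CompleteNormedModule R[i] H := {
  inner : {dot H for @Num.conj R[i]};
  sqr_norm_inner : forall f : H, `|f| ^+ 2 = inner f f
}.

#[short(type="hilbertType")]
HB.structure Definition Hilbert (R : realType) :=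
  {H of CompleteNormedModule R[i] H & CompleteNormedModule_isHilbert R H}.

Definition is_unitary (R : realType) (H : hilbertType R) (T : H -> H) : Prop :=
  [/\ linear T, bijective T & forall f g : H, inner (T f) (T g) = inner f g].

Record unitary_type (R : realType) (H : hilbertType R) := Unitary {
  unitary_fun :> H -> H;
  unitary_funP : is_unitary unitary_fun
}.

Notation "''U' ( H )" := (unitary_type H) (format "''U' ( H )") : type_scope.

Section unitary_group.
Variables (R : realType) (H : hilbertType R).
Implicit Types S T : 'U(H).

HB.instance Definition _ := gen_eqMixin 'U(H).
HB.instance Definition _ := gen_choiceMixin 'U(H).

Lemma unitary_ext S T : S =1 T -> S = T.
Proof.
case: S T => [s Ps] [t Pt] /= /funext st.
by case: _ / st Pt => Pt; rewrite (Prop_irrelevance Ps Pt).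
Qed.

Lemma is_unitary_id : is_unitary (@id H).
Proof. by split=> //; exists id. Qed.

Lemma is_unitary_comp S T : is_unitary (S \o T).
Proof.
have [sl sb si] := unitary_funP S; have [tl tb ti] := unitary_funP T.
split=> /=.
- by move=> a f g /=; rewrite tl sl.
- exact: bij_comp.
- by move=> f g; rewrite si ti.
Qed.

Lemma unitary_inv_ex T : exists g : H -> H, cancel T g /\ cancel g T.
Proof. by have [_ [g TK gK] _] := unitary_funP T; exists g. Qed.

Definition unitary_inv_fun T : H -> H := sval (cid (unitary_inv_ex T)).

Lemma unitary_funK T : cancel T (unitary_inv_fun T).
Proof. by rewrite /unitary_inv_fun; case: cid => g []. Qed.

Lemma unitary_inv_funK T : cancel (unitary_inv_fun T) T.
Proof. by rewrite /unitary_inv_fun; case: cid => g []. Qed.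

Lemma is_unitary_inv T : is_unitary (unitary_inv_fun T).
Proof.
have [tl _ ti] := unitary_funP T; split.
- move=> a f g; apply: (can_inj (unitary_funK T)).
  by rewrite tl !unitary_inv_funK.
- by exists T; [exact: unitary_inv_funK | exact: unitary_funK].
- by move=> f g; rewrite -ti !unitary_inv_funK.
Qed.

Definition unitary_one : 'U(H) := Unitary is_unitary_id.
Definition unitary_mul S T : 'U(H) := Unitary (is_unitary_comp S T).
Definition unitary_inv T : 'U(H) := Unitary (is_unitary_inv T).

Lemma unitary_mulA : associative unitary_mul.
Proof. by move=> S T V; exact: unitary_ext. Qed.

Lemma unitary_mul1 : left_id unitary_one unitary_mul.
Proof. by move=> T; exact: unitary_ext. Qed.

Lemma unitary_mulr1 : right_id unitary_one unitary_mul.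
Proof. by move=> T; exact: unitary_ext. Qed.

Lemma unitary_mulV : left_inverse unitary_one unitary_inv unitary_mul.
Proof. by move=> T; apply: unitary_ext => f /=; rewrite unitary_funK. Qed.

Lemma unitary_mulrV : right_inverse unitary_one unitary_inv unitary_mul.
Proof. by move=> T; apply: unitary_ext => f /=; rewrite unitary_inv_funK. Qed.

HB.instance Definition _ := isGroup.Build 'U(H)
  unitary_mulA unitary_mul1 unitary_mulr1 unitary_mulV unitary_mulrV.

HB.instance Definition _ := isPointed.Build 'U(H) unitary_one.

(* Strong topology: the indices are triples (T0, f, e), restricted to e > 0. *)
Definition strong_index : set ('U(H) * H * R) := [set i | 0 < i.2].

Definition strong_subbase (i : 'U(H) * H * R) : set 'U(H) :=
  let: (T0, f, e) := i in [set T : 'U(H) | `|T f - T0 f| < e%:C].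

HB.instance Definition _ :=
  isSubBaseTopological.Build 'U(H) strong_index strong_subbase.

End unitary_group.

(* Main.v *)
(** Strong convergence of unitaries is pointwise convergence in norm. Since
    unitaries are isometries, joint continuity of the product follows from
    [ST - S0 T0 = S (T - T0) + (S - S0) T0], and, with [g = T0^-1 f], that of
    the inverse from [|T^-1 f - T0^-1 f| = |T0 g - T g|]. *)
Require Import Defs.
From HB Require Import structures.
From mathcomp Require Import all_boot all_order all_algebra.
From mathcomp Require Import sesquilinear complex.
From mathcomp Require Import all_classical all_reals all_analysis.

Set Implicit Arguments.
Unset Strict Implicit.
Unset Printing Implicit Defensive.

Import Order.TTheory GRing.Theory Num.Theory.
Import numFieldNormedType.Exports.

Local Open Scope classical_set_scope.
Local Open Scope complex_scope.
Local Open Scope ring_scope.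

Section strong_topology.
Variables (R : realType) (H : hilbertType R).
Implicit Types (S T : 'U(H)) (f g : H).

Lemma unitaryB T f g : T (f - g) = T f - T g.
Proof.
have [Tlin _ _] := unitary_funP T.
by rewrite addrC -scaleN1r Tlin scaleN1r addrC.
Qed.

Lemma norm_unitary T f : `|T f| = `|f|.
Proof.
have [_ _ Tinner] := unitary_funP T.
by apply: (pexpIrn (n := 2)); rewrite ?nnegrE// !sqr_norm_inner Tinner.
Qed.

Lemma open_strong_subbase i : strong_index i -> open (strong_subbase (H := H) i).
Proof.
move=> Di; exists [set strong_subbase i]; last by rewrite bigcup_set1.
by move=> _ ->; exact: finI_from1.
Qed.

(** Reduces strong continuity to estimates at one vector at a time; the general filter covers both
    projections of the product and the identity map. *)
Lemma cvg_strongP (X : Type) (F : set_system X) {FF : Filter F}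
    (U : X -> 'U(H)) T :
  U @ F --> T <-> forall f, U x f @[x --> F] --> T f.
Proof.
split=> [UT f|UT A].
  apply/cvgrPdist_lt => e e0.
  (* A positive [e] in [R[i]] is real, so its real part can serve as the radius of a subbasic
     set. *)
  have eE : e = (complex.Re e)%:C by rewrite RRe_real// gtr0_real.
  have Re0 : 0 < complex.Re e by rewrite -ltcR -eE.
  have : nbhs T (strong_subbase (T, f, complex.Re e)).
    apply: open_nbhs_nbhs; split; first exact: open_strong_subbase.
    by rewrite /= subrr normr0 -eE.
  move=> /UT; apply: (@filterS _ F) => x /=.
  by rewrite -eE distrC.
(* Among the finite intersections of subbasic sets whose union is the open neighbourhood, [C] is one
   containing [T]. *)
rewrite nbhsE => -[B [[D' D'sub <-]] [C D'C CT] BA].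
apply: (@filterS _ F _ (U @^-1` C)).
  by move=> x Cx; apply: BA; exists C.
have [E Esub EC] := D'sub _ D'C.
rewrite -EC preimage_bigcap; apply: filter_bigI => -[[T1 f] e] Ei.
have /= T1fe : strong_subbase (T1, f, e) T by move: CT; rewrite -EC => /(_ _ Ei).
(* The centre [T1] may differ from [T]; the strict bound on the limit [T f - T1 f] holds eventually
   along [F]. *)
have UT1 : U x f - T1 f @[x --> F] --> T f - T1 f.
  by apply: cvgB; [exact: UT|exact: cvg_cst].
exact: cvgr_norm_lt UT1 _ T1fe.
Qed.

Lemma unitary_mul_continuous :
  continuous (fun p : 'U(H) * 'U(H) => (p.1 * p.2)%g).
Proof.
case=> S0 T0; apply/cvg_strongP => f /=.
have S0cvg : (fun p : 'U(H) * 'U(H) => p.1 (T0 f)) @ (S0, T0) --> S0 (T0 f).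
  by apply: (cvg_strongP fst S0).1; exact: cvg_fst.
have T0cvg : (fun p : 'U(H) * 'U(H) => p.2 f) @ (S0, T0) --> T0 f.
  by apply: (cvg_strongP snd T0).1; exact: cvg_snd.
apply/cvgrPdist_lt => e e0.
have e20 : 0 < e / 2 by rewrite divr_gt0.
near=> p.
(* The first term involves only the fixed vector [T0 f]; the second has norm independent of [p.1],
   an isometry. *)
have -> : S0 (T0 f) - p.1 (p.2 f) =
    (S0 (T0 f) - p.1 (T0 f)) + p.1 (T0 f - p.2 f).
  by rewrite unitaryB addrA subrK.
rewrite (splitr e) (le_lt_trans (ler_normD _ _))// norm_unitary ltrD//.
- by near: p; exact: cvgr_dist_lt.
- by near: p; exact: cvgr_dist_lt.
Unshelve. all: by end_near. Qed.

Lemma unitary_inv_continuous : continuous (fun T : 'U(H) => (T^-1)%g).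
Proof.
move=> T0; apply/(cvg_strongP (F := nbhs T0)) => f.
have T0cvg : (fun T : 'U(H) => T ((T0^-1)%g f)) @ T0 --> T0 ((T0^-1)%g f).
  by apply: (cvg_strongP (F := nbhs T0) id T0).1.
apply/cvgrPdist_lt => e e0; near=> T.
(* Applying the isometry [T] eliminates the varying inverse and leaves convergence at the fixed
   vector [T0^-1 f]. *)
rewrite -(norm_unitary T) unitaryB unitary_inv_funK.
rewrite -[X in _ - X](unitary_inv_funK T0) distrC.
by near: T; exact: cvgr_dist_lt.
Unshelve. all: by end_near. Qed.

End strong_topology.

Theorem proposition1 (R : realType) (H : hilbertType R) :
  continuous (fun p : 'U(H) * 'U(H) => (p.1 * p.2)%g) /\
  continuous (fun T : 'U(H) => (T^-1)%g).
Proof.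
by split; [exact: unitary_mul_continuous|exact: unitary_inv_continuous].
Qed.
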